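(* For all $f,g\in\mathbf{L}$, the following statements are equivalent: (i) $f\sqsubseteq g$; (ii) $f^{\hat a}\preccurlyeq g^{\hat a}$ for all $a\in(0,1)$; (iii) $f^{a}\preccurlyeq g^{a}$ for all $a\in(0,1)$.
   Context: $\mathbf{M}$ is the set of all functions $[0,1]\to[0,1]$; $\wedge$ denotes minimum. For $f,g\in\mathbf{M}$, $(f\wedge_\wedge g)(x)=\sup\{f(y)\wedge g(z)\mid y,z\in[0,1],\ y\wedge z=x\}$, and $f\sqsubseteq g$ iff $f\wedge_\wedge g=f$. $f\in\mathbf{M}$ is normal if $\sup_{x}f(x)=1$, and convex if $x\le y\le z$ implies $f(x)\wedge f(z)\le f(y)$. $\mathbf{L}$ is the set of all normal convex elements of $\mathbf{M}$. For $f\in\mathbf{M}$, $f^{a}=\{x\in[0,1]\mid f(x)\ge a\}$ and $f^{\hat a}=\{x\in[0,1]\mid f(x)>a\}$. A subinterval of $[0,1]$ is a non-empty convex subset of $[0,1]$. For subintervals $A,B$ of $[0,1]$, $A\wedge B=\{x\wedge y\mid x\in A,\ y\in B\}$ and $A\preccurlyeq B$ means $A\wedge B=A$. *)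

(* Defs.v *)
From mathcomp Require Import all_boot all_order all_algebra.
From mathcomp Require Import interval_inference boolp classical_sets reals.

Set Implicit Arguments.
Unset Strict Implicit.
Unset Printing Implicit Defensive.

Import Order.TTheory GRing.Theory Num.Theory.

Local Open Scope classical_set_scope.
Local Open Scope ring_scope.

Lemma sup_i01_ge0 (R : realType) (A : set {i01 R}) :
  0 <= sup [set x%:num | x in A].
Proof.
have [->|] := eqVneq A set0; first by rewrite image_set0 sup0.
move/set0P => [x Ax]; apply: (@le_trans _ _ x%:num) => //.
by apply: ub_le_sup; [exists 1 => _ [y _ <-] | exists x].
Qed.

Lemma sup_i01_le1 (R : realType) (A : set {i01 R}) :
  sup [set x%:num | x in A] <= 1.
Proof.
have [->|/set0P[x Ax]] := eqVneq A set0; first by rewrite image_set0 sup0.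
by apply: ge_sup; [exists x%:num, x | move=> _ [y _ <-]].
Qed.

Definition sup01 (R : realType) (A : set {i01 R}) : {i01 R} :=
  Itv01 (sup_i01_ge0 A) (sup_i01_le1 A).

Definition M (R : realType) : Type := {i01 R} -> {i01 R}.

Definition meetM (R : realType) (f g : M R) : M R := fun x =>
  sup01 [set t | exists y z : {i01 R},
    Order.min y z = x /\ t = Order.min (f y) (g z)].

Definition leM (R : realType) (f g : M R) : Prop := meetM f g = f.

Definition normalM (R : realType) (f : M R) : Prop :=
  (sup01 (range f))%:num = 1.

Definition convexM (R : realType) (f : M R) : Prop :=
  forall x y z : {i01 R}, x <= y -> y <= z -> Order.min (f x) (f z) <= f y.

Definition L (R : realType) : set (M R) := [set f | normalM f /\ convexM f].

Definition cut (R : realType) (f : M R) (a : R) : set {i01 R} :=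
  [set x | a <= (f x)%:num].

Definition strict_cut (R : realType) (f : M R) (a : R) : set {i01 R} :=
  [set x | a < (f x)%:num].

Definition subinterval (R : realType) (A : set {i01 R}) : Prop :=
  A !=set0 /\ forall x y z : {i01 R}, A x -> A z -> x <= y -> y <= z -> A y.

Definition meetI (R : realType) (A B : set {i01 R}) : set {i01 R} :=
  [set Order.min x y | x in A & y in B].

(* [leI] is only meant for subintervals; the cuts of elements of [L] at levels
   in the open unit interval are such, see [cut_subinterval] and
   [strict_cut_subinterval]. *)
Definition leI (R : realType) (A B : set {i01 R}) : Prop := meetI A B = A.

Lemma strict_cut_subinterval (R : realType) (f : M R) (a : R) :
  L f -> 0 < a < 1 -> subinterval (strict_cut f a).
Proof.
move=> [nf cf] /andP[_ a1]; split; last first.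
  move=> x y z; rewrite /strict_cut /= => fx fz xy yz.
  apply: (@lt_le_trans _ _ (Order.min (f x) (f z))%:num); last exact: cf xy yz.
  by rewrite minEle; case: ifP.
have s1 : sup [set x%:num | x in range f] = 1 by exact: nf.
have : a < sup [set x%:num | x in range f] by rewrite s1.
case/sup_gt; first by exists (f 0%:i01)%:num, (f 0%:i01) => //; exists 0%:i01.
by move=> _ [_ [x _ <-] <-] ax; exists x.
Qed.

Lemma cut_subinterval (R : realType) (f : M R) (a : R) :
  L f -> 0 < a < 1 -> subinterval (cut f a).
Proof.
move=> Lf a01; split.
  by have [[x /ltW ax] _] := strict_cut_subinterval Lf a01; exists x.
have [_ cf] := Lf; move=> x y z; rewrite /cut /= => fx fz xy yz.
apply: (@le_trans _ _ (Order.min (f x) (f z))%:num); last exact: cf xy yz.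
by rewrite minEle; case: ifP.
Qed.

(* Main.v *)
Require Import Defs.
From mathcomp Require Import all_boot all_order all_algebra.
From mathcomp Require Import interval_inference boolp classical_sets reals.

Import Order.TTheory GRing.Theory Num.Theory.

Local Open Scope classical_set_scope.
Local Open Scope ring_scope.

(** The strict cuts turn [meetM] into the elementwise meet [meetI], and a
    [[0,1]]-valued function is determined by its strict cuts at levels in the
    open unit interval; this settles (i) <-> (ii). Since a cut is the
    intersection of the strict cuts at lower levels, and a strict cut the union
    of the cuts at higher levels, (ii) and (iii) are transferred level by level.
    The only delicate point is to find, for [x] in [cut f a], some [y >= x] in
    [cut g a]: normality gives [w] with [a < g w], and if [w < x] then convexity
    of [g] between [w] and points beyond [x] forces [a <= g x]. *)

(** The empty set has supremum 0 by default, which would break the equivalence for negative [a]. *)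
Lemma lt_num_sup01 (R : realType) (A : set {i01 R}) (a : R) : A !=set0 ->
  a < (sup01 A)%:num <-> exists2 t, A t & a < t%:num.
Proof.
move=> [t0 At0]; split.
- case/sup_gt; first by exists t0%:num, t0.
  by move=> _ [t At <-] lt_at; exists t.
- move=> [t At lt_at]; apply: lt_le_trans lt_at _.
  by apply: ub_le_sup; [exists 1 => _ [y _ <-] | exists t].
Qed.

Lemma lt_num_min (R : realType) (u v : {i01 R}) (a : R) :
  (a < (Order.min u v)%:num) = (a < u%:num) && (a < v%:num).
Proof. by rewrite num_min lt_min. Qed.

(** A strict bound below a supremum is attained by some member; a non-strict one need not be, hence
    strict cuts. *)
Lemma strict_cut_meetM (R : realType) (f g : M R) (a : R) :
  strict_cut (meetM f g) a = meetI (strict_cut f a) (strict_cut g a).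
Proof.
apply/seteqP; split => x.
- case/lt_num_sup01; first by exists (Order.min (f x) (g x)), x, x; rewrite minxx.
  move=> _ [y [z [<- ->]]]; rewrite lt_num_min => /andP[fy gz].
  by exists y => //; exists z.
- move=> [y fy [z gz <-]]; apply/lt_num_sup01.
    by exists (Order.min (f y) (g z)), y, z.
  exists (Order.min (f y) (g z)); first by exists y, z.
  by rewrite lt_num_min; apply/andP.
Qed.

Lemma le_strict_cut (R : realType) (f g : M R) :
  (forall a : R, 0 < a < 1 -> strict_cut f a `<=` strict_cut g a) ->
  forall x, f x <= g x.
Proof.
move=> sfg x; rewrite leNgt; apply/negP => lt_gf.
(* The midpoint of two distinct values in [[0,1]] is a level strictly between 0 and 1. *)
have [lt_ga lt_af] := midf_lt (lt_gf : (g x)%:num < (f x)%:num).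
set a := (_ / _) in lt_ga lt_af.
have a01 : 0 < a < 1 by rewrite (le_lt_trans _ lt_ga)// (lt_le_trans lt_af).
by have := lt_trans lt_ga (sfg a a01 x lt_af); rewrite ltxx.
Qed.

Lemma leM_strict_cut (R : realType) (f g : M R) :
  leM f g <->
  forall a : R, 0 < a < 1 -> leI (strict_cut f a) (strict_cut g a).
Proof.
rewrite /leM /leI; split => [fg a _|fg]; first by rewrite -strict_cut_meetM fg.
apply/funext => x; apply/eqP; rewrite eq_le.
by apply/andP; split; apply: le_strict_cut => a a01;
  rewrite strict_cut_meetM fg.
Qed.

(** The conjuncts are the two inclusions of [meetI A B = A]; for the second, [x <= y] gives
    [x = min x y]. *)
Lemma leIP (R : realType) (A B : set {i01 R}) :
  leI A B <-> (forall x y, A x -> B y -> A (Order.min x y)) /\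
              (forall x, A x -> exists2 y, B y & x <= y).
Proof.
rewrite /leI; split => [AB|[minA ubB]].
- split => [x y Ax By|x]; first by rewrite -AB; exists x => //; exists y.
  by rewrite -{1}AB => -[u _ [y By <-]]; exists y; rewrite // ge_min lexx orbT.
- apply/seteqP; split => [_ [x Ax [y By <-]]|x Ax]; first exact: minA.
  by have [y By xy] := ubB x Ax; exists x => //; exists y; rewrite // min_l.
Qed.

Lemma cutP (R : realType) (f : M R) (a : R) (x : {i01 R}) : 0 < a ->
  cut f a x <-> forall b, 0 < b < a -> strict_cut f b x.
Proof.
move=> a0; split => [fx b /andP[_ ba]|fx]; first exact: lt_le_trans fx.
rewrite /cut /= leNgt; apply/negP => lt_fa.
have [lt_fb lt_ba] := midf_lt lt_fa; set b := (_ / _) in lt_fb lt_ba.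
have b0a : 0 < b < a by rewrite lt_ba (le_lt_trans _ lt_fb).
by have := lt_trans lt_fb (fx b b0a); rewrite ltxx.
Qed.

Lemma leI_cut (R : realType) (f g : M R) : L g ->
  (forall a : R, 0 < a < 1 -> leI (strict_cut f a) (strict_cut g a)) ->
  forall a : R, 0 < a < 1 -> leI (cut f a) (cut g a).
Proof.
move=> Lg fg a a01; have /andP[a0 a1] := a01.
have {}fg b : 0 < b < a -> leI (strict_cut f b) (strict_cut g b).
  by move=> /andP[b0 ba]; apply: fg; rewrite b0 (lt_trans ba).
apply/leIP; split => [x y fx gy|x fx].
  apply/(cutP _ _ _ _ a0) => b ba; have /leIP[minf _] := fg b ba.
  by apply: minf;
    [exact: (iffLR (cutP _ f a x a0)) | exact: (iffLR (cutP _ g a y a0))].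
have [[w gw] _] := strict_cut_subinterval Lg a01.
have [xw|wx] := leP x w; first by exists w => //; exact: ltW.
(* The point [y] found below varies with [b], so it cannot be the witness; [x], caught between [w]
   and every such [y], can. *)
exists x => //; apply/(cutP _ _ _ _ a0) => b ba; have /leIP[_ ubg] := fg b ba.
have [y gy xy] := ubg x (iffLR (cutP _ f a x a0) fx b ba).
have /andP[b0 lt_ba] := ba.
have [|_ convg] := @strict_cut_subinterval _ g b Lg.
  by rewrite b0 (lt_trans lt_ba).
by apply: (convg w x y) => //; [exact: lt_trans gw | exact: ltW].
Qed.

Lemma i01_between (R : realType) (a : R) (t : {i01 R}) :
  0 < a -> a < t%:num -> exists2 b, 0 < b < 1 & a < b <= t%:num.
Proof.
move=> a0 /midf_lt[lt_ab lt_bt]; exists ((a + t%:num) / 2); last first.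
  by rewrite lt_ab ltW.
by rewrite (lt_trans a0 lt_ab) (lt_le_trans lt_bt).
Qed.

Lemma leI_strict_cut (R : realType) (f g : M R) :
  (forall a : R, 0 < a < 1 -> leI (cut f a) (cut g a)) ->
  forall a : R, 0 < a < 1 -> leI (strict_cut f a) (strict_cut g a).
Proof.
move=> fg a /andP[a0 _]; apply/leIP; split => [x y fx gy|x fx].
  (* A single level [b] must serve both [f x] and [g y], so it is taken below their minimum. *)
  have : a < (Order.min (f x) (g y))%:num by rewrite lt_num_min; apply/andP.
  case/(i01_between _ _ _ a0) => b b01 /andP[ab].
  rewrite num_min le_min => /andP[bf bg].
  have /leIP[minf _] := fg b b01.
  exact: lt_le_trans ab (minf x y bf bg).
have [b b01 /andP[ab bf]] := i01_between _ _ _ a0 fx.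
have /leIP[_ ubg] := fg b b01; have [y gy xy] := ubg x bf.
by exists y => //; exact: lt_le_trans ab gy.
Qed.

Theorem proposition4p11 (R : realType) (f g : M R) (hf : L f) (hg : L g) :
  [<-> leM f g;
       forall a : R, 0 < a < 1 -> leI (strict_cut f a) (strict_cut g a);
       forall a : R, 0 < a < 1 -> leI (cut f a) (cut g a)].
Proof.
tfae.
- by move/leM_strict_cut.
- exact: leI_cut.
- by move=> fg; apply/leM_strict_cut; exact: leI_strict_cut.
Qed.
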